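(* Let $\Omega$ be a subgraph of a host graph with nonempty boundary $\partial\Omega$, let $a>0$ and $b>0$ be constants, and let $u_0:\overline{\Omega}\to\mathbb{R}$ satisfy $u_0\ge 0$, $u_0\not\equiv 0$ on $\Omega$. Then the problem $$u_t-\Delta_\Omega u=u(a-bu)\ (x\in\Omega,\ t>0),\qquad \frac{\partial u}{\partial_\Omega n}(x,t)=0\ (x\in\partial\Omega,\ t>0),\qquad u(x,0)=u_0(x)\ (x\in\Omega)$$ has a unique nonnegative global solution $u\in C^1(\Omega\times[0,\infty))\cap C^0(\overline{\Omega}\times[0,\infty))$, and $\lim_{t\to+\infty}u(x,t)=\frac{a}{b}$ uniformly for $x\in\overline{\Omega}$.
   Context: The host graph $G=(V,E)$ is finite, undirected and connected, with weight $\omega:V\times V\to[0,\infty)$, $\omega_{xy}=\omega_{yx}$, $\omega_{xy}=0$ iff $xy\notin E$, and measure $\mu:V\to(0,\infty)$. $\Omega$ is a connected, simple, induced subgraph (identified with its vertex set); $\partial\Omega=\{z\in V\setminus\Omega: z\sim y\text{ for some }y\in\Omega\}$ is assumed nonempty and $\overline{\Omega}=\Omega\cup\partial\Omega$. For $x\in\Omega$, $\Delta_\Omega u(x)=\sum_{y\in\overline{\Omega}}(u(y)-u(x))\frac{\omega_{yx}}{\mu(x)}$ (acting in $x$). For $z\in\partial\Omega$, $\frac{\partial u}{\partial_\Omega n}(z)=\sum_{y\in\Omega}(u(z)-u(y))\frac{\omega_{zy}}{\mu(z)}$. For a vertex set $A$ and interval $I$, $C^n(A\times I)$ denotes functions $u$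 with $u(x,\cdot)$ $n$ times continuously differentiable on $I$ for each $x\in A$ (one-sided at included endpoints). *)

(* Defs.v *)
From mathcomp Require Import all_boot all_order all_algebra.
From mathcomp Require Import all_classical all_reals all_analysis.

Set Implicit Arguments.
Unset Strict Implicit.
Unset Printing Implicit Defensive.

Import Order.TTheory GRing.Theory Num.Theory.
Import numFieldNormedType.Exports.

Local Open Scope classical_set_scope.
Local Open Scope ring_scope.

Record host_graph (R : realType) (V : finType) := HostGraph {
  edge : rel V;
  weight : V -> V -> R;
  vmeasure : V -> R;
  edge_sym : symmetric edge;
  edge_connected : forall x y : V, connect edge x y;
  weight_ge0 : forall x y : V, 0 <= weight x y;
  weight_sym : forall x y : V, weight x y = weight y x;
  weight_eq0 : forall x y : V, weight x y = 0 <-> ~~ edge x y;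
  vmeasure_gt0 : forall x : V, 0 < vmeasure x
}.

Section Subgraph.
Variables (R : realType) (V : finType) (G : host_graph R V) (Omega : {set V}).

Definition induced_edge : rel V :=
  [rel x y | [&& x \in Omega, y \in Omega & edge G x y]].

Definition induced_connected : Prop :=
  {in Omega &, forall x y, connect induced_edge x y}.

(* An edge relation has no multiple edges, so only loops are to be excluded. *)
Definition induced_simple : Prop := forall x, ~~ induced_edge x x.

Definition vboundary : {set V} :=
  [set z | (z \notin Omega) && [exists y in Omega, edge G z y]].

Definition vclosure : {set V} := (Omega :|: vboundary)%SET.

Definition laplacian (u : V -> R) (x : V) : R :=
  \sum_(y in vclosure) (u y - u x) * (weight G y x / vmeasure G x).

Definition normal_derivative (u : V -> R) (z : V) : R :=
  \sum_(y in Omega) (u z - u y) * (weight G z y / vmeasure G z).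

End Subgraph.

(* Derivative relative to [I]: two-sided at interior points of [I], one-sided
   at the endpoints that [I] contains. *)
Definition is_derive_within (R : realType) (I : set R) (f : R -> R) (t l : R)
    : Prop :=
  (f s - f t) / (s - t) @[s --> within I t^'] --> l.

Fixpoint Cn_within (R : realType) (n : nat) (I : set R) (f : R -> R) : Prop :=
  match n with
  | 0 => {within I, continuous f}
  | m.+1 => exists2 g : R -> R,
      forall t, I t -> is_derive_within I f t (g t) & Cn_within m I g
  end.

Definition Cn_on (R : realType) (V : finType) (n : nat) (A : {set V})
    (I : set R) (u : V -> R -> R) : Prop :=
  {in A, forall x, Cn_within n I (u x)}.

(* Functions on the closure of [Omega] times [0, +oo[ are represented by total
   functions [V -> R -> R]; only their values on that set are constrained. At
   [t > 0] the C^1 condition makes the total derivative [derive1 (u x) t] the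
   genuine one. *)
Record nonneg_global_solution (R : realType) (V : finType)
    (G : host_graph R V) (Omega : {set V}) (a b : R) (u0 : V -> R)
    (u : V -> R -> R) : Prop := NonnegGlobalSolution {
  sol_C1 : Cn_on 1 Omega `[0, +oo[ u;
  sol_C0 : Cn_on 0 (vclosure G Omega) `[0, +oo[ u;
  sol_ge0 : forall (x : V) (t : R), x \in vclosure G Omega -> 0 <= t -> 0 <= u x t;
  sol_eq : forall (x : V) (t : R), x \in Omega -> 0 < t ->
    derive1 (u x) t - laplacian G Omega (u^~ t) x = u x t * (a - b * u x t);
  sol_neumann : forall (x : V) (t : R), x \in vboundary G Omega -> 0 < t ->
    normal_derivative G Omega (u^~ t) x = 0;
  sol_init : forall x, x \in Omega -> u x 0 = u0 x
}.

(* Main.v *)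
Require Import Defs.
From mathcomp Require Import all_boot all_order all_algebra.
From mathcomp Require Import all_classical all_reals all_analysis.
From mathcomp Require Import ring lra.

Set Implicit Arguments.
Unset Strict Implicit.
Unset Printing Implicit Defensive.

Import Order.TTheory GRing.Theory Num.Theory.
Import numFieldNormedType.Exports.

Local Open Scope classical_set_scope.
Local Open Scope ring_scope.

(** The Neumann condition at a boundary vertex z says that u(z) is a weighted
average of the values of u on Omega, with weights depending on z only.
Substituting these averages into the Laplacian eliminates the boundary and
leaves an autonomous system of ordinary differential equations on Omega,

  u_x' = sum_(y in Omega) k(x, y) (u_y - u_x) + u_x (a - b u_x),

with a kernel k that is nonnegative, and positive along the edges of Omega
([laplacian_reduced], [reduced_kernel_gt0]). The solution of the original
problem is the solution of this system, extended to the boundary by the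
averages ([harmonic_extension_solution]); conversely every solution has this
form ([solution_logistic_flow], [solution_boundary_average]).

The reduced system has the following properties.

- Comparison: a subsolution that starts below a supersolution stays below it
  ([logistic_comparison]). The sum of the squares of the positive parts of the
  difference satisfies phi' <= C phi and vanishes at the start, hence vanishes
  forever ([linear_maximum_principle]). Uniqueness follows by comparing two
  solutions in both directions.

- Global existence: clipping the argument of the reaction term to an interval
  [0, M] makes the right-hand side globally Lipschitz, so that Picard iteration
  converges on the whole half-line ([global_picard]). The maximum principle
  keeps the solution in [0, M] as soon as M is above u0 and above a / b, and
  there clipping has no effect ([logistic_flow_exists]).

- Instantaneous positivity: up to an integrating factor, u_x is nondecreasing
  with a source sum_y k(x, y) u_y, so positivity at one vertex spreads along
  the edges to all of Omega in arbitrarily short time ([logistic_flow_gt0]).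

- Convergence: at time 1 the solution is at least a positive constant, and from
  then on it is squeezed between two barriers constant in space,
  a / b + C exp(-lam (t - 1)) for suitable constants C of either sign
  ([logistic_flow_attracted]). An average of values close to a / b is close to
  a / b, so the same rate holds on the boundary. *)

(** * Derivatives and continuity on a half-line *)

Lemma is_derive_continuous (R : realType) (f : R -> R) (t l : R) :
  is_derive t 1 f l -> {for t, continuous f}.
Proof.
by case=> df _; apply: differentiable_continuous; exact/derivable1_diffP.
Qed.

Lemma is_derive_quotient (R : realType) (f : R -> R) (t l : R) :
  is_derive t 1 f l <-> (f s - f t) / (s - t) @[s --> t^'] --> l.
Proof.
split=> [/is_derive1_caratheodory[g [fE cg <-]]|fl].
  move/continuous_withinNx : cg; apply: cvg_trans.
  apply: near_eq_cvg; near=> s; rewrite fE mulfK// subr_eq0.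
  by near: s; exact: nbhs_dnbhs_neq.
apply/is_derive1_caratheodory.
exists (fun s => if s == t then l else (f s - f t) / (s - t)); split.
- move=> s; case: eqP => [->|/eqP]; first by rewrite !subrr mulr0.
  by rewrite -subr_eq0 => /divfK->.
- apply/continuous_withinNx; rewrite eqxx; apply: cvg_trans fl.
  apply: near_eq_cvg; near=> s; rewrite ifN//.
  by near: s; exact: nbhs_dnbhs_neq.
- by rewrite eqxx.
Unshelve. all: by end_near. Qed.

Lemma is_derive_is_derive_within (R : realType) (I : set R) (f : R -> R)
    (t l : R) :
  is_derive t 1 f l -> is_derive_within I f t l.
Proof.
move=> /is_derive_quotient; apply: cvg_trans.
exact/cvg_app/cvg_within.
Qed.

Lemma is_derive_within_is_derive (R : realType) (f : R -> R) (t l : R) :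
  0 < t -> is_derive_within `[0, +oo[ f t l -> is_derive t 1 f l.
Proof.
move=> t0 fl; apply/is_derive_quotient; apply: cvg_trans fl.
apply: cvg_app => A tA.
have t0oo : t^' [set s | 0 < s] by apply: nbhs_dnbhs; exact: lt_nbhsr.
by apply: filterS2 t0oo tA => s s0; apply; rewrite /= in_itv/= andbT ltW.
Qed.

(** Integrating from -1 instead of 0 makes the derivative at t = 0
two-sided, so that no one-sided calculus is needed for the solutions built
from this antiderivative. *)
Lemma continuous_antiderivative (R : realType) (f : R -> R) :
  continuous f ->
  exists2 F : R -> R, F 0 = 0 & forall t : R, 0 <= t -> is_derive t 1 F (f t).
Proof.
move=> cf.
pose J (t : R) := (\int[@lebesgue_measure R]_(s in `[(-1)%R, t]) f s)%R.
exists (fun t => J t - J 0) => [|t t0]; first by rewrite subrr.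
have [dJ J'] : derivable J t 1 /\ derive1 J t = f t.
  apply: (@continuous_FTC1 R f (BLeft (-1)) t (t + 1)).
  - by rewrite ltrDl.
  - apply: continuous_compact_integrable; first exact: segment_compact.
    exact: continuous_subspaceT.
  - by apply: lt_le_trans t0; rewrite oppr_lt0.
  - exact: cf.
have -> : (fun t => J t - J 0) = J - cst (J 0) by [].
have hJ : is_derive t 1 J (f t) by rewrite -J' derive1E; exact: DeriveDef.
by apply: is_derive_eq; rewrite subr0.
Qed.

(** Mean value inequality with a variable bound: both g + f and g - f are
nondecreasing. *)
Lemma le_norm_increment (R : realType) (f g f' g' : R -> R) :
  (forall t : R, 0 <= t -> is_derive t 1 f (f' t)) ->
  (forall t : R, 0 <= t -> is_derive t 1 g (g' t)) ->
  (forall t : R, 0 <= t -> `|f' t| <= g' t) ->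
  forall t : R, 0 <= t -> `|f t - f 0| <= g t - g 0.
Proof.
move=> df dg fg.
have incr (h h' : R -> R) : (forall t : R, 0 <= t -> is_derive t 1 h (h' t)) ->
    (forall t : R, 0 <= t -> 0 <= h' t) -> forall t : R, 0 <= t -> h 0 <= h t.
  move=> dh h0 t t0.
  apply: (@ger0_derive1_ndecry _ h 0) => // [s|s|].
  - by rewrite in_itv/= andbT => /ltW/dh[].
  - rewrite in_itv/= andbT => /ltW s0.
    by rewrite derive1E (@derive_val _ _ _ _ _ _ _ (dh s s0)); exact: h0.
  - apply: derivable_within_continuous => s; rewrite in_itv/= andbT => s0.
    by have [] := dh s s0.
move=> t t0; rewrite ler_norml; apply/andP; split.
- have : (g + f) 0 <= (g + f) t.
    apply: (incr _ (fun t => g' t + f' t)) => // s s0.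
    + by have := dg s s0; have := df s s0 => *; exact: is_deriveD.
    + by have := fg s s0; rewrite ler_norml => /andP[]; lra.
  by rewrite !fctE; lra.
- have : (g - f) 0 <= (g - f) t.
    apply: (incr _ (fun t => g' t - f' t)) => // s s0.
    + by have := dg s s0; have := df s s0 => *; exact: is_deriveB.
    + by have := fg s s0; rewrite ler_norml => /andP[]; lra.
  by rewrite !fctE; lra.
Qed.

Lemma is_derive_expR_linear (R : realType) (c t : R) :
  is_derive t 1 (fun s => expR (c * s)) (expR (c * t) * c).
Proof.
have dmul : is_derive t (1 : R) (fun s => c * s) c.
  by apply: is_derive_eq; rewrite -[RHS]mulr1.
exact: (@is_derive1_comp _ expR (fun s => c * s)).
Qed.

Lemma max0_continuous (R : realType) : continuous (fun s : R => Num.max s 0).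
Proof.
move=> s; apply: (@continuous_max _ _ id (cst 0)).
- exact: cvg_id.
- exact: cvg_cst.
Qed.

Lemma is_derive_big_sum (R : realType) (I : Type) (r : seq I) (P : pred I)
    (f : I -> R -> R) (f' : I -> R) (t : R) :
  (forall i, P i -> is_derive t 1 (f i) (f' i)) ->
  is_derive t 1 (fun s => \sum_(i <- r | P i) f i s) (\sum_(i <- r | P i) f' i).
Proof.
move=> df; elim: r => [|i r IH].
  rewrite big_nil [X in is_derive _ _ X _](_ : _ = cst 0).
    exact: is_derive_cst.
  by apply/funext => s; rewrite big_nil.
rewrite big_cons.
rewrite [X in is_derive _ _ X _](_ : _ = (fun s =>
    if P i then f i s + \sum_(j <- r | P j) f j s
    else \sum_(j <- r | P j) f j s)).
  by case: ifP => [/df dfi|_] //; exact: is_deriveD.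
by apply/funext => s; rewrite big_cons.
Qed.

Lemma within_continuous_big_sum (R : realType) (D : set R) (I : Type)
    (r : seq I) (P : pred I) (f : I -> R -> R) :
  (forall i, P i -> {within D, continuous (f i)}) ->
  {within D, continuous (fun s => \sum_(i <- r | P i) f i s)}.
Proof.
move=> cf; elim: r => [|i r IH].
  rewrite [X in {within _, continuous X}](_ : _ = cst 0).
    by move=> s; exact: cvg_cst.
  by apply/funext => s; rewrite big_nil.
rewrite [X in {within _, continuous X}](_ : _ = (fun s =>
    if P i then f i s + \sum_(j <- r | P j) f j s
    else \sum_(j <- r | P j) f j s)).
  by case Pi: (P i) => //; apply: within_continuousD => //; exact: cf.
by apply/funext => s; rewrite big_cons.
Qed.

Lemma within_continuous_comp (R : realType) (D : set R) (p f : R -> R) :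
  continuous p -> {within D, continuous f} ->
  {within D, continuous (fun s => p (f s))}.
Proof. by move=> cp cf s; apply: continuous_comp; [exact: cf|exact: cp]. Qed.

Lemma within_continuous_scale (R : realType) (D : set R) (c : R) (f : R -> R) :
  {within D, continuous f} -> {within D, continuous (fun t => c * f t)}.
Proof. by move=> cf s; apply: cvgM; [exact: cvg_cst|exact: cf]. Qed.

(** Extends to t = 0 the boundary identity, which the Neumann condition
gives for t > 0 only. *)
Lemma within_continuous_eq_at_left_end (R : realType) (f g : R -> R) :
  {within `[0, +oo[, continuous f} -> {within `[0, +oo[, continuous g} ->
  (forall t, 0 < t -> f t = g t) -> f 0 = g 0.
Proof.
move=> /continuous_within_itvcyP[_ f0] /continuous_within_itvcyP[_ g0] fg.
suff : g x @[x --> 0^'+] --> f 0 by move/(cvg_unique (@Rhausdorff R)); exact.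
apply: cvg_trans f0; apply: near_eq_cvg; near=> t; apply: fg.
by near: t; exact: nbhs_right_gt.
Unshelve. all: by end_near. Qed.

Lemma uniform_exponential_cvg (R : realType) (U : choiceType) (A : set U)
    (u : R -> U -> R) (f : U -> R) (C lam : R) :
  0 < lam ->
  (forall x t, A x -> 1 <= t -> `|u t x - f x| <= C * expR (lam * (1 - t))) ->
  {uniform A, u @ +oo --> f}.
Proof.
move=> lam_gt0 uf P /uniform_nbhs[E [entE EP]].
move: entE; rewrite -entourage_ballE => -[e /= e_gt0 eE].
have el0 : 0 < e * lam by exact: mulr_gt0.
have T0 : 0 <= `|C| / (e * lam) by rewrite divr_ge0// ltW.
(* Since expR s >= 1 + s, the bound is below e once lam (t - 1) > |C| / e. *)
exists (1 + `|C| / (e * lam)); split; first exact: num_real.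
move=> t Tt; apply: EP => x Ax; apply: eE; rewrite /ball/= distrC.
have t1 : 1 <= t by apply: le_trans (ltW Tt); rewrite lerDl.
apply: le_lt_trans (uf x t Ax t1) _.
have -> : lam * (1 - t) = - (lam * (t - 1)) by ring.
rewrite expRN ltr_pdivrMr ?expR_gt0//.
apply: le_lt_trans (ler_norm _) _.
have : 1 + lam * (t - 1) <= expR (lam * (t - 1)) by exact: expR_ge1Dx.
rewrite -(ler_pM2l e_gt0) => /(lt_le_trans _); apply.
move: Tt; rewrite -ltrBrDl ltr_pdivrMr//; nra.
Qed.

(** Squaring makes the positive part differentiable: x |-> max(x, 0)^2 has
derivative 2 max(x, 0), with a remainder of at most the squared increment. *)
Lemma is_derive_sqr_pos_part (R : realType) (f : R -> R) (t l : R) :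
  is_derive t 1 f l ->
  is_derive t 1 (fun s => Num.max (f s) 0 ^+ 2) (2 * Num.max (f t) 0 * l).
Proof.
move=> df; pose p (x : R) := Num.max x 0 ^+ 2.
suff dp : is_derive (f t) 1 p (2 * Num.max (f t) 0).
  exact: (@is_derive1_comp _ p f).
have pE (x s : R) : `|p s - p x - 2 * Num.max x 0 * (s - x)| <= (s - x) ^+ 2.
  have sx_ge0 := sqr_ge0 (s - x).
  have s_ge0 := sqr_ge0 s; have x_ge0 := sqr_ge0 x.
  rewrite /p ler_norml; have [x0|x0] := leP x 0; have [s0|s0] := leP s 0.
  - by rewrite !expr0n/= !mulr0 !mul0r !subrr oppr_le0 sx_ge0.
  - have sx0 : s * x <= 0 by rewrite mulr_ge0_le0// ltW.
    by apply/andP; split; lra.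
  - have sx0 : s * x <= 0 by rewrite mulr_le0_ge0// ltW.
    by apply/andP; split; lra.
  - by apply/andP; split; lra.
apply/is_derive_quotient/cvgrPdist_le => e e0; near=> s.
have sx : s != f t by near: s; exact: nbhs_dnbhs_neq.
have sx0 : 0 < `|s - f t| by rewrite normr_gt0 subr_eq0.
have -> : 2 * Num.max (f t) 0 - (p s - p (f t)) / (s - f t) =
    - (p s - p (f t) - 2 * Num.max (f t) 0 * (s - f t)) / (s - f t).
  by field; rewrite subr_eq0.
rewrite mulNr normrN normrM normfV ler_pdivrMr//.
apply: le_trans (pE _ _) _.
rewrite -real_normK ?num_real// expr2 ler_pM2r// distrC.
by near: s; apply: nbhs_dnbhs; exists e => //= s /ltW.
Unshelve. all: by end_near. Qed.

(** * Global solutions of Lipschitz systems *)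

Lemma geometric_half_small (R : realType) (c e : R) :
  0 < e -> exists n, c / 2 ^+ n < e.
Proof.
move=> e0; have /cvgrPdist_lt/(_ _ e0)[n _ /(_ n (leqnn n))] :
    geometric c (2^-1 : R) @ \oo --> 0.
  by apply: cvg_geometric; rewrite ger0_norm// invf_lt1// ltr1n.
rewrite /geometric/= sub0r normrN exprVn => /(le_lt_trans (ler_norm _)).
by exists n.
Qed.

Lemma geometric_increments_limit (R : realType) (s : nat -> R) (c : R) :
  (forall n, `|s n.+1 - s n| <= c / 2 ^+ n) ->
  exists l, forall n, `|s n - l| <= 2 * c / 2 ^+ n.
Proof.
move=> sS.
have c0 : 0 <= c.
  by have := sS 0%N; rewrite expr0 divr1; exact/le_trans/normr_ge0.
have tail n m : `|s (n + m)%N - s n| <= 2 * c / 2 ^+ n - 2 * c / 2 ^+ (n + m).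
  elim: m => [|m IH]; first by rewrite addn0 !subrr normr0.
  rewrite addnS -(subrK (s (n + m)%N) (s (n + m).+1)) -addrA.
  apply: le_trans (ler_normD _ _) _; apply: le_trans (lerD (sS _) IH) _.
  rewrite exprS invfM; set p := (2 ^+ (n + m))^-1; lra.
have tail' n m : (n <= m)%N -> `|s m - s n| <= 2 * c / 2 ^+ n.
  move=> /subnKC <-; apply: le_trans (tail _ _) _.
  by rewrite gerBl divr_ge0 ?mulr_ge0// exprn_ge0.
have cs : cvg (s @ \oo).
  apply/cauchy_cvgP/cauchy_exP => e /(geometric_half_small (2 * c))[n ne].
  exists (s n); exists n => // m /= nm; rewrite /ball/= distrC.
  exact: le_lt_trans (tail' _ _ nm) ne.
exists (lim (s @ \oo)) => n; apply/ler_addgt0Pr => e e0.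
have /cvgrPdist_lt/(_ _ e0)[m _ sm] := cs.
have := sm (maxn n m) (leq_maxr _ _); have := tail' n (maxn n m) (leq_maxl _ _).
set l := lim _; rewrite distrC => h1 h2.
rewrite -(subrK (s (maxn n m)) (s n)) -addrA.
apply: le_trans (ler_normD _ _) _; apply: lerD => //.
by rewrite distrC ltW.
Qed.

Definition sup_lipschitz (R : realType) (V : finType) (L : R)
    (F : (V -> R) -> V -> R) : Prop :=
  forall (u v : V -> R) (c : R), (forall x, `|u x - v x| <= c) ->
    forall x, `|F u x - F v x| <= L * c.

Lemma sup_lipschitz_continuous (R : realType) (V : finType) (L : R)
    (F : (V -> R) -> V -> R) (w : V -> R -> R) :
  0 < L -> sup_lipschitz L F -> (forall x, continuous (w x)) ->
  forall x, continuous (fun t => F (w^~ t) x).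
Proof.
move=> L0 FL cw x t; apply/cvgrPdist_le => e e0; near=> s.
rewrite -(divfK (lt0r_neq0 L0) e) mulrC.
apply: FL => y; move: y; near: s; apply: filter_forall => y.
by have /cvgrPdist_le := cw y t; apply; rewrite divr_gt0.
Unshelve. all: by end_near. Qed.

(** Picard iteration in the norm weighted by exp(2 L t): integrating a bound
C exp(2 L t), multiplied by the Lipschitz constant L, yields half of that
bound, so the iteration is a contraction on the whole half-line at once and no
continuation argument is needed. *)
Lemma global_picard (R : realType) (V : finType) (F : (V -> R) -> V -> R)
    (L : R) (u0 : V -> R) :
  0 < L -> sup_lipschitz L F ->
  exists u : V -> R -> R, (forall x, u x 0 = u0 x) /\
    forall x (t : R), 0 <= t -> is_derive t 1 (u x) (F (u^~ t) x).
Proof.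
move=> L0 FL.
have /choice[A A_antider] : forall f : R -> R, exists Af : R -> R,
    continuous f ->
    Af 0 = 0 /\ forall t : R, 0 <= t -> is_derive t 1 Af (f t).
  move=> f; have [cf|ncf] := pselect (continuous f).
    by have [Af Af0 dAf] := continuous_antiderivative cf; exists Af.
  by exists f.
(* Iterates are controlled for t >= 0 only; replacing them by their value at
   time 0 for negative t makes every integrand continuous on the whole line. *)
pose frozen (w : V -> R -> R) x (t : R) := w x (Num.max t 0).
pose step (w : V -> R -> R) x t := u0 x + A (fun s => F ((frozen w)^~ s) x) t.
pose adm (w : V -> R -> R) := forall x, continuous (frozen w x).
have step0 w x : adm w -> step w x 0 = u0 x.
  move=> cw; rewrite /step (proj1 (A_antider _ _)) ?addr0//.
  exact: sup_lipschitz_continuous FL cw x.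
have dstep w x (t : R) : adm w -> 0 <= t ->
    is_derive t 1 (step w x) (F (w^~ t) x).
  move=> cw t0.
  have [_ /(_ _ t0) dA] :=
    A_antider _ (sup_lipschitz_continuous L0 FL cw (x := x)).
  have -> : F (w^~ t) x = 0 + F ((frozen w)^~ t) x.
    by rewrite add0r; congr (F _ x); apply/funext => y; rewrite /frozen max_l.
  exact: (@is_deriveD _ _ _ (cst (u0 x))).
have adm_step w : adm w -> adm (step w).
  move=> cw x t; apply: (continuous_comp (@max0_continuous R t)).
  apply: is_derive_continuous (dstep w x _ cw _).
  by rewrite le_max lexx orbT.
pose g t := expR (2 * L * t).
have dg (c t : R) : is_derive t 1 (fun t => c * g t) (c * (2 * L) * g t).
  have dexp : is_derive t 1 g (g t * (2 * L)) :=
    is_derive_expR_linear (2 * L) t.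
  have -> : c * (2 * L) * g t = c *: (g t * (2 * L)).
    by rewrite -[RHS]/(c * _); ring.
  exact: is_deriveZ.
have g1 (t : R) : 0 <= t -> 1 <= g t.
  by move=> t0; rewrite -[leLHS]expR0 ler_expR !mulr_ge0// ltW.
have g0 t : 0 < g t by exact: expR_gt0.
have contr w w' C : adm w -> adm w' ->
    (forall x (t : R), 0 <= t -> `|w x t - w' x t| <= C * g t) ->
    forall x (t : R), 0 <= t -> `|step w x t - step w' x t| <= C / 2 * g t.
  move=> cw cw' ww' x t t0.
  have C0 : 0 <= C.
    have := ww' x 0 (lexx _); rewrite /g mulr0 expR0 mulr1.
    exact/le_trans/normr_ge0.
  have := @le_norm_increment R (step w x - step w' x) (fun t => C / 2 * g t)
    (fun t => F (w^~ t) x - F (w'^~ t) x) (fun t => C / 2 * (2 * L) * g t)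
    _ (fun t _ => dg (C / 2) t) _ t t0.
  rewrite !fctE !step0// subrr subr0 => h; apply: le_trans (h _ _) _.
  - by move=> s s0; apply: is_deriveB; exact: dstep.
  - move=> s s0; have -> : C / 2 * (2 * L) * g s = L * (C * g s) by field.
    by apply: FL => y; exact: ww'.
  - by rewrite gerBl mulr_ge0// ?divr_ge0// ltW.
pose U n := iter n step (fun x _ => u0 x).
have admU n : adm (U n).
  elim: n => [x t|n IH]; last exact: adm_step.
  exact: cvg_cst.
pose C := \sum_x `|F u0 x| / (2 * L).
have C0 : 0 <= C by apply: sumr_ge0 => x _; rewrite divr_ge0// mulr_ge0// ltW.
have incr n : forall x (t : R), 0 <= t ->
    `|U n.+1 x t - U n x t| <= C / 2 ^+ n * g t.
  elim: n => [|n IH] x t t0; last first.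
    rewrite exprSr invfM mulrA.
    exact: contr (admU _) (admU _) IH x t t0.
  have := @le_norm_increment R (step (U 0%N) x) (fun t => C * g t)
    (fun t => F u0 x) (fun t => C * (2 * L) * g t)
    (fun t t0 => dstep (U 0%N) x t (admU 0%N) t0) (fun t _ => dg C t) _ t t0.
  rewrite step0// expr0 divr1 => h; apply: le_trans (h _) _.
  - move=> s s0; rewrite -[leLHS]mulr1 ler_pM// ?g1//.
    rewrite -ler_pdivrMr ?mulr_gt0// /C (bigD1 x)//= lerDl.
    by apply: sumr_ge0 => y _; rewrite divr_ge0// mulr_ge0// ltW.
  - by rewrite gerBl mulr_ge0// ltW.
have /choice[u Uu] : forall x, exists ux : R -> R, forall t, 0 <= t -> forall n,
    `|U n x t - ux t| <= 2 * (C * g t) / 2 ^+ n.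
  move=> x.
  have /choice[ux Uux] : forall t : R, exists l : R, 0 <= t -> forall n,
      `|U n x t - l| <= 2 * (C * g t) / 2 ^+ n.
    move=> t; have [t0|t0] := leP 0 t; last by exists 0.
    have [|l Ul] := @geometric_increments_limit R (fun n => U n x t) (C * g t).
      by move=> n; rewrite mulrAC; exact: incr.
    by exists l.
  by exists ux.
(* The convergence of the iterates is uniform near t, hence the limit is
   continuous. *)
have adm_u : adm u.
  move=> x t; apply/cvgrPdist_lt => e e0.
  pose c := 2 * (C * g (Num.max t 0 + 1)).
  have [n cn] := geometric_half_small c (divr_gt0 e0 (ltr0Sn R 2)).
  have near_u s : Num.max s 0 <= Num.max t 0 + 1 ->
      `|frozen (U n) x s - frozen u x s| < e / 3.
    move=> st; apply: le_lt_trans cn; apply: le_trans (Uu x _ _ n) _.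
      by rewrite le_max lexx orbT.
    rewrite ler_wpM2r ?invr_ge0 ?exprn_ge0// ler_wpM2l// ler_wpM2l//.
    by rewrite ler_expR ler_wpM2l// mulr_ge0// ltW.
  have /cvgrPdist_lt/(_ _ (divr_gt0 e0 (ltr0Sn R 2))) cU := admU n x t.
  near=> s.
  have us : `|frozen (U n) x s - frozen u x s| < e / 3.
    apply: near_u; rewrite -lerBlDl; near: s.
    have /cvgrPdist_le/(_ _ ltr01) := @max0_continuous R t.
    by apply: filterS => s; rewrite distrC; exact/le_trans/ler_norm.
  have {}near_u : `|frozen (U n) x t - frozen u x t| < e / 3.
    by apply: near_u; rewrite lerDl.
  have Us : `|frozen (U n) x t - frozen (U n) x s| < e / 3 by near: s.
  rewrite !ltr_norml in us near_u Us *; lra.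
(* The limit is a fixed point: step u and u are both at distance O(2^-n) from
   the iterate U n.+1. *)
have stepu x t : 0 <= t -> step u x t = u x t.
  move=> t0; apply/eqP; rewrite -subr_eq0 -normr_eq0 eq_le normr_ge0 andbT.
  apply/ler_addgt0Pr => e e0; rewrite add0r.
  have [n cn] := geometric_half_small (3 * (C * g t)) e0.
  have h1 : `|step (U n) x t - step u x t| <= 2 * C / 2 ^+ n / 2 * g t.
    apply: contr => // y s s0.
    by apply: le_trans (Uu y s s0 n) _; rewrite mulrA mulrAC.
  have h2 : `|U n.+1 x t - u x t| <= 2 * (C * g t) / 2 ^+ n.+1 by exact: Uu.
  have -> : step u x t - u x t =
      U n.+1 x t - u x t - (step (U n) x t - step u x t).
    by rewrite /=; lra.
  apply: le_trans (ler_normB _ _) _; apply: le_trans (lerD h2 h1) _.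
  apply: le_trans (ltW cn); rewrite exprSr invfM; set p := _^-1.
  have : 0 <= C * g t * p.
    by rewrite mulr_ge0// ?invr_ge0 ?exprn_ge0// mulr_ge0// ltW.
  lra.
exists (step u); split=> [x|x t t0]; first exact: step0.
have -> : (step u)^~ t = u^~ t by apply/funext => y; exact: stepu.
exact: dstep.
Unshelve. all: by end_near. Qed.

(** * The maximum principle *)

(** With p the positive part of w, one has p_x (w_y - w_x) <= p_x p_y - p_x^2
<= p_y^2, so the energy phi = sum_x p_x^2 satisfies phi' <= C phi, and
phi exp(-C t) is nonincreasing from the value 0. The differential inequality
is needed only where w is positive because p_x vanishes elsewhere. *)
Lemma linear_maximum_principle (R : realType) (V : finType) (A : {set V})
    (k : V -> V -> R) (K t0 : R) (w w' : V -> R -> R) :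
  (forall x y, 0 <= k x y) -> 0 <= K ->
  (forall x, x \in A -> {within `[t0, +oo[, continuous (w x)}) ->
  (forall x (t : R), x \in A -> t0 < t -> is_derive t 1 (w x) (w' x t)) ->
  (forall x t, x \in A -> t0 < t -> 0 < w x t ->
    w' x t <= \sum_(y in A) k x y * (w y t - w x t) + K * w x t) ->
  (forall x, x \in A -> w x t0 <= 0) ->
  forall x t, x \in A -> t0 <= t -> w x t <= 0.
Proof.
move=> k0 K0 cw dw w'le wt0.
pose p x t := Num.max (w x t) 0.
pose phi t := \sum_(x in A) p x t ^+ 2.
pose phi' t := \sum_(x in A) 2 * p x t * w' x t.
pose C := 2 * (\sum_x \sum_y k x y) + 2 * K.
have p0 x t : 0 <= p x t by rewrite le_max lexx orbT.
have phi'le t : t0 < t -> phi' t <= C * phi t.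
  move=> tt0.
  have term x : x \in A -> 2 * p x t * w' x t <=
      2 * (\sum_(y in A) k x y * p y t ^+ 2) + 2 * K * p x t ^+ 2.
    move=> xA; have [wx0|wx0] := leP (w x t) 0.
      rewrite /p max_r// mulr0 mul0r expr0n/= mulr0 addr0 mulr_ge0//.
      by apply: sumr_ge0 => y _; rewrite mulr_ge0// exprn_ge0// p0.
    rewrite [p x t]max_l; last exact: ltW.
    rewrite -mulrA -(mulrA 2 K) -mulrDr ler_pM2l//.
    apply: le_trans (ler_wpM2l (ltW wx0) (w'le x t xA tt0 wx0)) _.
    rewrite mulrDr; apply: lerD; last by rewrite le_eqVlt mulrCA expr2 eqxx.
    rewrite mulr_sumr; apply: ler_sum => y yA; rewrite mulrCA ler_wpM2l//.
    have wp : w y t <= p y t by rewrite le_max lexx.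
    have h1 : 0 <= w x t * (p y t - w y t) by rewrite mulr_ge0 ?subr_ge0// ltW.
    have h2 := sqr_ge0 (w x t - p y t); have h3 := sqr_ge0 (w x t).
    have h4 := sqr_ge0 (p y t); lra.
  apply: le_trans (ler_sum _ term) _.
  rewrite big_split/= -!mulr_sumr /C [leRHS]mulrDl; apply: lerD => //.
  rewrite -mulrA ler_pM2l// mulr_suml [leRHS](bigID (mem A))/=.
  apply: le_trans (ler_wpDr _ (lexx _)); last first.
    apply: sumr_ge0 => x _; apply: mulr_ge0; first exact: sumr_ge0.
    by apply: sumr_ge0 => y _; rewrite exprn_ge0.
  apply: ler_sum => x _; rewrite mulr_suml [leRHS](bigID (mem A))/=.
  apply: le_trans (ler_wpDr _ (lexx _)); last first.
    apply: sumr_ge0 => y _; apply: mulr_ge0 => //.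
    by apply: sumr_ge0 => z _; rewrite exprn_ge0.
  apply: ler_sum => y yA; rewrite ler_wpM2l// /phi (bigD1 y)//= lerDl.
  by apply: sumr_ge0 => z _; rewrite exprn_ge0.
pose e t := expR (- C * t).
have de (t : R) : is_derive t 1 e (e t * - C) := is_derive_expR_linear (- C) t.
have dphi (t : R) : t0 < t -> is_derive t 1 phi (phi' t).
  move=> tt0; apply: is_derive_big_sum => x xA.
  by apply: is_derive_sqr_pos_part; exact: dw.
pose psi t := phi t * e t.
have dpsi (t : R) : t0 < t ->
    is_derive t 1 psi (phi t * (e t * - C) + e t * phi' t).
  by move=> tt0; have dphit := dphi t tt0; exact: is_deriveM.
have psi_decr t : t0 <= t -> psi t <= psi t0.
  move=> tt0; apply: (@ler0_derive1_nincry _ psi t0) => // [s|s|].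
  - by rewrite in_itv/= andbT => /dpsi[].
  - rewrite in_itv/= andbT => s0.
    rewrite derive1E (@derive_val _ _ _ _ _ _ _ (dpsi s s0)).
    have := phi'le s s0; have : 0 < e s := expR_gt0 _; nra.
  - have cphi : {within `[t0, +oo[, continuous phi}.
      apply: within_continuous_big_sum => x xA.
      apply: (@within_continuous_comp _ _ (fun s => Num.max s 0 ^+ 2));
        last exact: cw.
      move=> s; apply: is_derive_continuous.
      by apply: is_derive_sqr_pos_part; exact: is_derive_id.
    have ce : {within `[t0, +oo[, continuous e}.
      by apply: continuous_subspaceT => s; apply: is_derive_continuous.
    by move=> s; apply: cvgM; [exact: cphi|exact: ce].
move=> x t xA tt0.
have phit0 : phi t0 = 0.
  by apply: big1 => y yA; rewrite /p max_r ?expr0n//; exact: wt0.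
have phit : phi t <= 0.
  by have := psi_decr t tt0; rewrite /psi phit0 mul0r pmulr_lle0// expR_gt0.
have : p x t ^+ 2 <= 0.
  apply: le_trans phit; rewrite /phi (bigD1 x)//= lerDl.
  by apply: sumr_ge0 => y _; rewrite exprn_ge0.
rewrite -[X in _ <= X](expr0n _ 2) ler_pXn2r ?nnegrE//.
by apply: le_trans; rewrite le_max lexx.
Qed.

(** * Elimination of the boundary *)

Definition diffusion (R : realType) (V : finType) (k : V -> V -> R)
    (A : {set V}) (v : V -> R) (x : V) : R :=
  \sum_(y in A) k x y * (v y - v x).

(** The probability that a random walk at z, forced to step into Omega, goes
to y. *)
Definition harmonic_weight (R : realType) (V : finType) (G : host_graph R V)
    (Omega : {set V}) (z y : V) : R :=
  (weight G z y / vmeasure G z) /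
  \sum_(y' in Omega) weight G z y' / vmeasure G z.

Definition harmonic_extension (R : realType) (V : finType) (G : host_graph R V)
    (Omega : {set V}) (v : V -> R) (x : V) : R :=
  if x \in Omega then v x
  else \sum_(y in Omega) harmonic_weight G Omega x y * v y.

(** The jump rate from x to y: directly, or through a boundary vertex z, from
which the walk returns to Omega at once. *)
Definition reduced_kernel (R : realType) (V : finType) (G : host_graph R V)
    (Omega : {set V}) (x y : V) : R :=
  weight G y x / vmeasure G x +
  \sum_(z in vboundary G Omega)
    harmonic_weight G Omega z y * (weight G z x / vmeasure G x).

Section BoundaryElimination.
Context (R : realType) (V : finType) (G : host_graph R V) (Omega : {set V}).

Lemma rate_ge0 x y z : 0 <= weight G x y / vmeasure G z.
Proof. by rewrite divr_ge0 ?weight_ge0// ltW// vmeasure_gt0. Qed.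

Lemma rate_gt0 x y z : edge G x y -> 0 < weight G x y / vmeasure G z.
Proof.
move=> xy; rewrite divr_gt0 ?vmeasure_gt0// lt_def weight_ge0 andbT.
by apply/eqP => /weight_eq0; rewrite xy.
Qed.

Lemma boundary_rate_gt0 z : z \in vboundary G Omega ->
  0 < \sum_(y in Omega) weight G z y / vmeasure G z.
Proof.
rewrite inE => /andP[_ /'exists_andP[y [yO zy]]].
rewrite (bigD1 y)//= ltr_pwDl ?rate_gt0//.
by apply: sumr_ge0 => x _; exact: rate_ge0.
Qed.

Lemma harmonic_weight_ge0 z y : 0 <= harmonic_weight G Omega z y.
Proof.
by rewrite divr_ge0 ?rate_ge0//; apply: sumr_ge0 => x _; exact: rate_ge0.
Qed.

Lemma sum_harmonic_weight z : z \in vboundary G Omega ->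
  \sum_(y in Omega) harmonic_weight G Omega z y = 1.
Proof. by move=> zb; rewrite -mulr_suml divff// gt_eqF// boundary_rate_gt0. Qed.

Lemma reduced_kernel_ge0 x y : 0 <= reduced_kernel G Omega x y.
Proof.
rewrite addr_ge0 ?rate_ge0//; apply: sumr_ge0 => z _.
by rewrite mulr_ge0 ?harmonic_weight_ge0 ?rate_ge0.
Qed.

Lemma reduced_kernel_gt0 x y : edge G x y -> 0 < reduced_kernel G Omega x y.
Proof.
move=> xy; rewrite ltr_pwDl ?rate_gt0 1?edge_sym//; apply: sumr_ge0 => z _.
by rewrite mulr_ge0 ?harmonic_weight_ge0 ?rate_ge0.
Qed.

Lemma normal_derivative_eq0 (u : V -> R) z : z \in vboundary G Omega ->
  normal_derivative G Omega u z = 0 <->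
  u z = \sum_(y in Omega) harmonic_weight G Omega z y * u y.
Proof.
move=> zb; have S0 := boundary_rate_gt0 zb.
have -> : \sum_(y in Omega) harmonic_weight G Omega z y * u y =
    (\sum_(y in Omega) u y * (weight G z y / vmeasure G z)) /
    \sum_(y in Omega) weight G z y / vmeasure G z.
  by rewrite mulr_suml; apply: eq_bigr => y _; rewrite [LHS]mulrC [LHS]mulrA.
rewrite /normal_derivative.
under eq_bigr do rewrite mulrBl.
rewrite sumrB -mulr_sumr; split=> [/eqP|->].
  by rewrite subr_eq0 => /eqP <-; rewrite mulfK// gt_eqF.
by rewrite divfK ?subrr// gt_eqF.
Qed.

Lemma laplacian_reduced (u : V -> R) x :
  (forall z, z \in vboundary G Omega ->
    u z = \sum_(y in Omega) harmonic_weight G Omega z y * u y) ->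
  laplacian G Omega u x = diffusion (reduced_kernel G Omega) Omega u x.
Proof.
move=> uz; rewrite /laplacian (big_setID Omega)/=.
have -> : (vclosure G Omega :&: Omega)%SET = Omega.
  by apply/finset.setIidPr; exact: finset.subsetUl.
have -> : (vclosure G Omega :\: Omega)%SET = vboundary G Omega.
  apply/finset.setP => z; rewrite !inE; case: (z \in Omega) => //=.
rewrite /diffusion.
under [RHS]eq_bigr do rewrite mulrDl.
rewrite big_split/=; congr (_ + _).
  by apply: eq_bigr => y _; rewrite mulrC.
under [RHS]eq_bigr do rewrite mulr_suml.
rewrite exchange_big/=; apply: eq_bigr => z zb.
rewrite uz// -[X in _ - X]mul1r -(sum_harmonic_weight zb).
rewrite mulr_suml -sumrB mulr_suml.
by apply: eq_bigr => y _; ring.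
Qed.

Lemma harmonic_extension_in (v : V -> R) x : x \in Omega ->
  harmonic_extension G Omega v x = v x.
Proof. by rewrite /harmonic_extension => ->. Qed.

Lemma harmonic_extension_boundary (v : V -> R) z : z \in vboundary G Omega ->
  harmonic_extension G Omega v z =
  \sum_(y in Omega) harmonic_weight G Omega z y * v y.
Proof. by rewrite /harmonic_extension inE => /andP[/negPf ->]. Qed.

(** The form in which [laplacian_reduced] and [normal_derivative_eq0] use the
extension, as a function on all of V. *)
Lemma harmonic_extension_fix (v : V -> R) z : z \in vboundary G Omega ->
  harmonic_extension G Omega v z =
  \sum_(y in Omega)
    harmonic_weight G Omega z y * harmonic_extension G Omega v y.
Proof.
move=> zb; rewrite harmonic_extension_boundary//.
by apply: eq_bigr => y yO; rewrite harmonic_extension_in.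
Qed.

Lemma harmonic_extension_dist (v : V -> R) (c e : R) x :
  (forall y, y \in Omega -> `|v y - c| <= e) -> x \in vclosure G Omega ->
  `|harmonic_extension G Omega v x - c| <= e.
Proof.
move=> ve; rewrite finset.in_setU => /orP[xO|xb].
  by rewrite harmonic_extension_in// ve.
rewrite harmonic_extension_boundary// -[c]mul1r -(sum_harmonic_weight xb).
rewrite mulr_suml -sumrB; under eq_bigr do rewrite -mulrBr.
apply: le_trans (ler_norm_sum _ _ _) _.
rewrite -[leRHS]mul1r -(sum_harmonic_weight xb) mulr_suml.
apply: ler_sum => y yO; rewrite normrM ger0_norm ?harmonic_weight_ge0//.
by rewrite ler_wpM2l ?harmonic_weight_ge0// ve.
Qed.

End BoundaryElimination.

(** * The logistic equation on a network *)

Lemma dist_clip_le (R : realType) (M s t : R) :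
  `|Num.min (Num.max s 0) M - Num.min (Num.max t 0) M| <= `|s - t|.
Proof.
have dist_max (x y : R) : `|Num.max x 0 - Num.max y 0| <= `|x - y|.
  have := ler_norm (x - y); have := ler_norm (y - x); rewrite (distrC y x).
  move: `|x - y| => d; rewrite ler_norml.
  by have [?|?] := leP x 0; have [?|?] := leP y 0; move=> *;
    apply/andP; split; lra.
have dist_min (x y : R) : `|Num.min x M - Num.min y M| <= `|x - y|.
  have := ler_norm (x - y); have := ler_norm (y - x); rewrite (distrC y x).
  move: `|x - y| => d; rewrite ler_norml.
  by have [?|?] := leP x M; have [?|?] := leP y M; move=> *;
    apply/andP; split; lra.
exact: le_trans (dist_min _ _) (dist_max _ _).
Qed.

Section LogisticNetwork.
Context (R : realType) (V : finType) (k : V -> V -> R) (A : {set V}) (a b : R).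
Context (k_ge0 : forall x y, 0 <= k x y) (a_gt0 : 0 < a) (b_gt0 : 0 < b).

Definition logistic_rhs (v : V -> R) (x : V) : R :=
  diffusion k A v x + v x * (a - b * v x).

Definition logistic_flow (u : V -> R -> R) : Prop :=
  [/\ forall x, x \in A -> {within `[0, +oo[, continuous (u x)},
      forall x (t : R), x \in A -> 0 < t ->
        is_derive t 1 (u x) (logistic_rhs (u^~ t) x)
    & forall x t, x \in A -> 0 <= t -> 0 <= u x t].

Lemma diffusion_cst (c : R) x : diffusion k A (fun=> c) x = 0.
Proof. by apply: big1 => y _; rewrite subrr mulr0. Qed.

(** The difference of the reaction terms is (u - v)(a - b (u + v)), which is at
most a (u - v) where u > v, because u and v are nonnegative: a one-sided
Lipschitz bound that requires no upper bound on the solutions. *)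
Lemma logistic_comparison (t0 : R) (u v u' v' : V -> R -> R) :
  (forall x, x \in A -> {within `[t0, +oo[, continuous (u x)}) ->
  (forall x, x \in A -> {within `[t0, +oo[, continuous (v x)}) ->
  (forall x (t : R), x \in A -> t0 < t -> is_derive t 1 (u x) (u' x t)) ->
  (forall x (t : R), x \in A -> t0 < t -> is_derive t 1 (v x) (v' x t)) ->
  (forall x t, x \in A -> t0 < t -> 0 <= u x t) ->
  (forall x t, x \in A -> t0 < t -> 0 <= v x t) ->
  (forall x t, x \in A -> t0 < t -> u' x t <= logistic_rhs (u^~ t) x) ->
  (forall x t, x \in A -> t0 < t -> logistic_rhs (v^~ t) x <= v' x t) ->
  (forall x, x \in A -> u x t0 <= v x t0) ->
  forall x t, x \in A -> t0 <= t -> u x t <= v x t.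
Proof.
move=> cu cv du dv u0 v0 u'le v'ge uv0 x t xA tt0; rewrite -subr_le0.
apply: (@linear_maximum_principle R V A k a t0 (fun x => u x - v x)
  (fun x s => u' x s - v' x s)) => //; first exact: ltW.
- by move=> y yA; apply: within_continuousB; [exact: cu|exact: cv].
- by move=> y s yA ts; apply: is_deriveB; [exact: du|exact: dv].
- move=> y s yA ts; rewrite !fctE => uv.
  have -> : \sum_(z in A) k y z * (u z s - v z s - (u y s - v y s)) =
      diffusion k A (u^~ s) y - diffusion k A (v^~ s) y.
    by rewrite -sumrB; apply: eq_bigr => z _; ring.
  have := u'le y s yA ts; have := v'ge y s yA ts; rewrite /logistic_rhs.
  have : 0 <= b * (u y s - v y s) * (u y s + v y s).
    apply: mulr_ge0; last by rewrite addr_ge0 ?u0 ?v0.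
    by apply: mulr_ge0; exact: ltW.
  lra.
- by move=> y yA; rewrite !fctE subr_le0 uv0.
Qed.

Lemma logistic_flow_le (u v : V -> R -> R) :
  logistic_flow u -> logistic_flow v ->
  (forall x, x \in A -> u x 0 <= v x 0) ->
  forall x t, x \in A -> 0 <= t -> u x t <= v x t.
Proof.
move=> [cu du u0] [cv dv v0] uv x t xA t0.
by apply: (logistic_comparison cu cv du dv) => // y s yA s0;
  [exact/u0/ltW|exact/v0/ltW].
Qed.

Lemma logistic_flow_exists (u0 : V -> R) :
  (forall x, x \in A -> 0 <= u0 x) ->
  exists (u : V -> R -> R) (M : R),
    [/\ forall x, u x 0 = u0 x,
        forall x (t : R), x \in A -> 0 <= t ->
          is_derive t 1 (u x) (logistic_rhs (u^~ t) x)
      & forall x t, x \in A -> 0 <= t -> 0 <= u x t <= M].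
Proof.
move=> u0_ge0.
pose M := a / b + \sum_(x in A) u0 x.
have ab_gt0 : 0 < a / b by rewrite divr_gt0.
have M_ge : a / b <= M by rewrite lerDl; exact: sumr_ge0.
have M_ge0 : 0 <= M by apply: le_trans M_ge; exact: ltW.
have u0_le x : x \in A -> u0 x <= M.
  move=> xA; rewrite /M (bigD1 x)//= addrCA lerDl addr_ge0 ?(ltW ab_gt0)//.
  by apply: sumr_ge0 => y /andP[/u0_ge0].
(* At 0 the reaction vanishes, and at M >= a / b it is nonpositive: hence both
   ends of [0, M] are barriers for the clipped equation. *)
pose clip (s : R) := Num.min (Num.max s 0) M.
have clip_ge0 s : 0 <= clip s by rewrite le_min M_ge0 le_max lexx orbT.
have clip_le s : clip s <= M by rewrite ge_min lexx orbT.
pose F (v : V -> R) x := diffusion k A v x + clip (v x) * (a - b * clip (v x)).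
pose L := \sum_x \sum_y k x y * 2 + (a + b * (2 * M)).
have L_gt0 : 0 < L.
  rewrite ltr_wpDl//.
    by apply: sumr_ge0 => x _; apply: sumr_ge0 => y _; rewrite mulr_ge0.
  by rewrite ltr_wpDr// !mulr_ge0// ltW.
have F_lip : sup_lipschitz L F.
  move=> v w c vw x.
  have c0 : 0 <= c by apply: le_trans (vw x).
  rewrite /F /L opprD addrACA mulrDl; apply: le_trans (ler_normD _ _) _.
  apply: lerD.
    rewrite -sumrB; apply: le_trans (ler_norm_sum _ _ _) _.
    rewrite mulr_suml [leRHS](bigD1 x)//= ler_wpDr//.
      apply: sumr_ge0 => y _; rewrite mulr_ge0//.
      by apply: sumr_ge0 => z _; rewrite mulr_ge0.
    rewrite mulr_suml [leRHS](bigID (mem A))/= ler_wpDr//.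
      by apply: sumr_ge0 => y _; rewrite !mulr_ge0.
    apply: ler_sum => y _.
    rewrite -mulrBr normrM ger0_norm// -mulrA ler_wpM2l//.
    have -> : v y - v x - (w y - w x) = v y - w y - (v x - w x) by ring.
    by apply: le_trans (ler_normB _ _) _; rewrite mulr_natl mulr2n lerD.
  have -> : clip (v x) * (a - b * clip (v x)) -
      clip (w x) * (a - b * clip (w x)) =
      (a - b * (clip (v x) + clip (w x))) * (clip (v x) - clip (w x)) by ring.
  rewrite normrM ler_pM//; last exact: le_trans (dist_clip_le _ _ _) (vw x).
  apply: le_trans (ler_normB _ _) _; rewrite gtr0_norm// lerD2l.
  rewrite normrM gtr0_norm// ler_wpM2l//; first exact: ltW.
  by rewrite ger0_norm ?addr_ge0// mulr_natl mulr2n lerD.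
have [u [u_init du]] := global_picard u0 L_gt0 F_lip.
have cu x : {within `[0, +oo[, continuous (u x)}.
  apply: derivable_within_continuous => s; rewrite in_itv/= andbT => s0.
  by have [] := du x s s0.
have u_ge0 x t : x \in A -> 0 <= t -> 0 <= u x t.
  move=> xA t0; rewrite -oppr_le0.
  apply: (@linear_maximum_principle R V A k 0 0 (fun x => - u x)
    (fun x s => - F (u^~ s) x)) => //.
  - by move=> y yA s; apply: cvgN; exact: cu.
  - by move=> y s yA s0; apply: is_deriveN; exact/du/ltW.
  - move=> y s yA s0; rewrite !fctE oppr_gt0 => us.
    rewrite /F [clip (u y s)](_ : _ = 0); last first.
      by rewrite /clip max_r ?min_l// ltW.
    rewrite !mul0r !addr0 /diffusion -sumrN le_eqVlt; apply/orP; left.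
    by apply/eqP; apply: eq_bigr => z _; rewrite !fctE; ring.
  - by move=> y yA; rewrite !fctE oppr_le0 u_init u0_ge0.
have u_le x t : x \in A -> 0 <= t -> u x t <= M.
  move=> xA t0; rewrite -subr_le0.
  apply: (@linear_maximum_principle R V A k 0 0 (fun x => u x - cst M)
    (fun x s => F (u^~ s) x - 0)) => //.
  - by move=> y yA; apply: within_continuousB => // s; exact: cvg_cst.
  - by move=> y s yA s0; apply: is_deriveB; exact/du/ltW.
  - move=> y s yA s0; rewrite !fctE subr_gt0 => us.
    have us0 : 0 < u y s by exact: le_lt_trans us.
    rewrite /F [clip (u y s)](_ : _ = M); last first.
      by rewrite /clip max_l ?min_r// ltW.
    rewrite mul0r addr0 subr0 /diffusion -[leRHS]addr0 lerD//.
      by apply: ler_sum => z _; rewrite !fctE opprB addrA subrK.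
    rewrite mulr_ge0_le0// subr_le0.
    by move: M_ge; rewrite ler_pdivrMr// mulrC.
  - by move=> y yA; rewrite !fctE subr_le0 u_init u0_le.
exists u, M; split=> // [x t xA t0|x t xA t0]; last by rewrite u_ge0 ?u_le.
have -> : logistic_rhs (u^~ t) x = F (u^~ t) x.
  by rewrite /F /clip max_l ?u_ge0// min_l// u_le.
exact: du.
Qed.

(** For K large, exp(K t) u_y has a derivative of at least
exp(K t) sum_z k(y, z) u_z >= 0. It is thus nondecreasing, which preserves
positivity at x0; and it is increasing as soon as some z with k(y, z) > 0
carries a positive value, which passes positivity from z to y. *)
Lemma logistic_flow_gt0 (u : V -> R -> R) (M : R) (e : rel V) x0 x :
  logistic_flow u ->
  (forall x t, x \in A -> 0 <= t -> u x t <= M) ->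
  (forall x y, e x y -> [/\ x \in A, y \in A & 0 < k y x]) ->
  x0 \in A -> 0 < u x0 0 -> connect e x0 x -> forall t, 0 < t -> 0 < u x t.
Proof.
move=> [cu du u_ge0] uM ek x0A ux0 /connectP[p ep ->].
(* The total outgoing rate absorbs the negative part of the diffusion, and b M
   the term - b u^2, since u <= M. *)
pose K y := \sum_(z in A) k y z + b * M.
pose g y t := u y t * expR (K y * t).
pose g' y t := u y t * (expR (K y * t) * K y) +
  expR (K y * t) * logistic_rhs (u^~ t) y.
have cg y : y \in A -> {within `[0, +oo[, continuous (g y)}.
  move=> yA s; apply: cvgM; first exact: cu.
  apply: continuous_subspaceT => r.
  exact: is_derive_continuous (is_derive_expR_linear (K y) r).
have dg y (t : R) : y \in A -> 0 < t -> is_derive t 1 (g y) (g' y t).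
  move=> yA t0; have duy := du y t yA t0.
  have de := is_derive_expR_linear (K y) t.
  exact: is_deriveM.
have g'ge y t : y \in A -> 0 < t ->
    expR (K y * t) * (\sum_(z in A) k y z * u z t) <= g' y t.
  move=> yA t0; rewrite /g' mulrCA -mulrDr ler_pM2l ?expR_gt0//.
  rewrite /logistic_rhs /diffusion /K.
  under [X in _ <= _ + (X + _)]eq_bigr do rewrite mulrBr.
  rewrite sumrB -mulr_suml.
  have := u_ge0 y t yA (ltW t0); have := uM y t yA (ltW t0).
  set v := u y t => vM v0.
  have : 0 <= a * v by rewrite mulr_ge0// ltW.
  have : 0 <= b * (M - v) * v by rewrite !mulr_ge0 ?subr_ge0// ltW.
  lra.
have source_ge0 y t : 0 < t -> 0 <= \sum_(z in A) k y z * u z t.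
  by move=> t0; apply: sumr_ge0 => z zA; rewrite mulr_ge0 ?u_ge0// ltW.
have {ux0} : forall t, 0 < t -> 0 < u x0 t.
  move=> t t0; have : g x0 0 <= g x0 t.
    apply: (@ger0_derive1_ndecry _ (g x0) 0) => //; last 2 first.
    - exact: cg.
    - exact: ltW.
    - by move=> s; rewrite in_itv/= andbT => /(dg _ _ x0A)[].
    - move=> s; rewrite in_itv/= andbT => s0.
      rewrite derive1E (@derive_val _ _ _ _ _ _ _ (dg _ s x0A s0)).
      apply: le_trans (g'ge _ _ x0A s0); rewrite mulr_ge0 ?expR_ge0//.
      exact: source_ge0.
  rewrite /g mulr0 expR0 mulr1 => /(lt_le_trans ux0).
  by rewrite pmulr_lgt0// expR_gt0.
elim: p x0 x0A ep => [|y p IH] z zA//= /andP[/ek[_ yA kyz] yp] uz.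
apply: IH => // t t0; have : g y 0 < g y t.
  apply: (@gtr0_derive1_lt_cc _ (g y) 0 t) => //.
  - by move=> s; rewrite in_itv/= => /andP[/(dg _ _ yA)[]].
  - move=> s; rewrite in_itv/= => /andP[s0 _].
    rewrite derive1E (@derive_val _ _ _ _ _ _ _ (dg _ s yA s0)).
    apply: lt_le_trans (g'ge _ _ yA s0); rewrite mulr_gt0 ?expR_gt0//.
    rewrite (bigD1 z)//= ltr_pwDl ?mulr_gt0 ?uz//.
    by apply: sumr_ge0 => w /andP[wA _]; rewrite mulr_ge0 ?u_ge0// ltW.
  - apply: continuous_subspaceW (cg y yA) => s /=.
    by rewrite !in_itv/= andbT => /andP[].
  - by rewrite in_itv/= lexx ltW.
  - by rewrite in_itv/= lexx ltW.
rewrite {1}/g mulr0 expR0 mulr1 => /(le_lt_trans (u_ge0 _ _ yA (lexx 0))).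
by rewrite /g pmulr_lgt0// expR_gt0.
Qed.

(** On a barrier w = a / b + q constant in space the diffusion vanishes and the
reaction is - (a + b q) q. For q = C exp(-lam (t - 1)) with C >= 0, w is a
supersolution if lam <= a. For C = - (a / b - eps), w is a subsolution if
lam <= b eps, as w stays above eps. The rate lam = b eps serves both. *)
Lemma logistic_flow_attracted (u : V -> R -> R) (M : R) :
  logistic_flow u ->
  (forall x t, x \in A -> 0 <= t -> u x t <= M) ->
  (forall x, x \in A -> 0 < u x 1) ->
  exists C lam : R, 0 < lam /\ forall x t, x \in A -> 1 <= t ->
    `|u x t - a / b| <= C * expR (lam * (1 - t)).
Proof.
move=> [cu du u_ge0] uM u1.
have ab_gt0 : 0 < a / b by rewrite divr_gt0.
have abK : b * (a / b) = a by rewrite mulrC divfK// gt_eqF.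
(* Capping eps at half of a / b makes lam <= a, and keeps the lower barrier
   below a / b. *)
pose eps := \big[Num.min/(a / b / 2)]_(x in A) u x 1.
have eps_gt0 : 0 < eps by apply: lt_bigmin => //; rewrite divr_gt0.
have eps_u x : x \in A -> eps <= u x 1 by move=> xA; exact: bigmin_le_cond.
have eps_le : eps <= a / b / 2 by exact: bigmin_le_id.
pose lam := b * eps.
have lam_gt0 : 0 < lam by exact: mulr_gt0.
have lam_le : lam <= a.
  rewrite /lam -abK ler_pM2l//; apply: le_trans eps_le _.
  by rewrite ler_pdivrMr// ler_peMr ?(ltW ab_gt0)// ler1n.
pose d t := expR (lam * (1 - t)).
have d_gt0 t : 0 < d t by exact: expR_gt0.
have d_le1 t : 1 <= t -> d t <= 1.
  by move=> t1; rewrite -expR0 ler_expR pmulr_rle0// subr_le0.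
have d1 : d 1 = 1 by rewrite /d subrr mulr0 expR0.
have dbar (c t : R) :
    is_derive t 1 (fun s => a / b + c * d s) (- lam * (c * d t)).
  have dlin : is_derive t (1 : R) (fun s => lam * (1 - s)) (- lam).
    by apply: is_derive_eq; rewrite /GRing.scale/=; ring.
  have dd : is_derive t 1 d (d t * - lam).
    exact: (@is_derive1_comp _ expR (fun s => lam * (1 - s))).
  have -> : - lam * (c * d t) = 0 + c *: (d t * - lam).
    by rewrite -[c *: _]/(c * _); ring.
  exact: (@is_deriveD _ _ _ (cst (a / b)) (fun s => c * d s)).
have cbar (c : R) : {within `[1, +oo[, continuous (fun s => a / b + c * d s)}.
  by apply: continuous_subspaceT => s; exact: is_derive_continuous (dbar c s).
have cu1 x : x \in A -> {within `[1, +oo[, continuous (u x)}.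
  move=> xA; apply: continuous_subspaceW (cu x xA) => s /=.
  by rewrite !in_itv/= !andbT; exact: le_trans.
have pos t : (1 : R) < t -> 0 < t by apply: lt_trans.
have du1 x (t : R) : x \in A -> 1 < t ->
    is_derive t 1 (u x) (logistic_rhs (u^~ t) x).
  by move=> xA /pos; exact: du.
have u_ge01 x t : x \in A -> 1 < t -> 0 <= u x t.
  by move=> xA /pos/ltW; exact: u_ge0.
have rhs_bar c t x :
    logistic_rhs (fun=> a / b + c * d t) x =
    - (a + b * (c * d t)) * (c * d t).
  rewrite /logistic_rhs diffusion_cst add0r.
  by have := abK; move: (a / b) (c * d t) => r q <-; ring.
pose Cu := a / b + M.
pose Cl := a / b - eps.
have upper x t : x \in A -> 1 <= t -> u x t <= a / b + Cu * d t.
  move=> xA t1.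
  have M_ge0 : 0 <= M by apply: le_trans (uM x 1 xA ler01); exact: u_ge0.
  have Cu_ge0 : 0 <= Cu by rewrite addr_ge0// ltW.
  apply: (logistic_comparison cu1 (fun y _ => cbar Cu)
    du1 (fun y s _ _ => dbar Cu s)) => //.
  - by move=> y s yA s1; rewrite addr_ge0 ?(ltW ab_gt0)// mulr_ge0// ltW.
  - move=> y s yA s1; rewrite rhs_bar.
    have q0 : 0 <= Cu * d s by rewrite mulr_ge0// ltW.
    rewrite ler_wpM2r// lerN2; apply: le_trans lam_le _.
    by rewrite lerDl mulr_ge0// ltW.
  - move=> y yA; rewrite d1 mulr1; apply: le_trans (uM y 1 yA ler01) _.
    by rewrite /Cu; have := ltW ab_gt0; lra.
have lower x t : x \in A -> 1 <= t -> a / b + - Cl * d t <= u x t.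
  move=> xA t1.
  have Cl_ge0 : 0 <= Cl.
    by rewrite subr_ge0; apply: le_trans eps_le _; have := ltW ab_gt0; lra.
  have Cld s : 1 <= s -> Cl * d s <= Cl by move=> s1; rewrite ler_piMr ?d_le1.
  apply: (logistic_comparison (fun y _ => cbar (- Cl)) cu1
    (fun y s _ _ => dbar (- Cl) s) du1) => //.
  - move=> y s yA s1; have := Cld s (ltW s1); rewrite {2}/Cl.
    by have := ltW eps_gt0; lra.
  - move=> y s yA s1; rewrite rhs_bar.
    have q0 : 0 <= Cl * d s by rewrite mulr_ge0// ltW.
    rewrite [- Cl * _]mulNr; have q1 : b * (Cl * d s) <= a - lam.
      by rewrite /lam -[X in X - _]abK -mulrBr ler_pM2l// Cld// ltW.
    rewrite !mulrN !mulNr opprK; set q := Cl * d s in q0 q1 *.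
    have : 0 <= q * (a - lam - b * q) by rewrite mulr_ge0// subr_ge0.
    lra.
  - by move=> y yA; rewrite d1 mulr1 /Cl opprB addrCA subrr addr0 eps_u.
exists (Cu + a / b), lam; split=> // x t xA t1.
have M_ge0 : 0 <= M by apply: le_trans (uM x 1 xA ler01); exact: u_ge0.
have := upper x t xA t1; have := lower x t xA t1; rewrite -/(d t) /Cl /Cu.
have h1 : 0 <= a / b * d t by rewrite mulr_ge0// ltW.
have h2 : 0 <= eps * d t by rewrite mulr_ge0// ltW.
have h3 : 0 <= M * d t by rewrite mulr_ge0// ltW.
move=> l r; rewrite ler_norml; apply/andP; split; lra.
Qed.

End LogisticNetwork.

(** * Equivalence with the reduced system *)

Section Reduction.
Context (R : realType) (V : finType) (G : host_graph R V) (Omega : {set V}).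
Context (a b : R) (u0 : V -> R).
Let k := reduced_kernel G Omega.

Lemma solution_boundary_average (v : V -> R -> R) z t :
  nonneg_global_solution G Omega a b u0 v ->
  z \in vboundary G Omega -> 0 <= t ->
  v z t = \sum_(y in Omega) harmonic_weight G Omega z y * v y t.
Proof.
move=> sv zb; have avg s : 0 < s ->
    v z s = \sum_(y in Omega) harmonic_weight G Omega z y * v y s.
  move=> s0; apply/normal_derivative_eq0 => //.
  exact: sol_neumann sv _ _ zb s0.
rewrite le_eqVlt => /predU1P[<-|/avg//].
apply: (@within_continuous_eq_at_left_end _ (v z)
  (fun s => \sum_(y in Omega) harmonic_weight G Omega z y * v y s)) => //.
  by apply: (sol_C0 sv); rewrite finset.in_setU zb orbT.
apply: within_continuous_big_sum => y yO; apply: within_continuous_scale.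
by apply: (sol_C0 sv); rewrite finset.in_setU yO.
Qed.

Lemma solution_logistic_flow (v : V -> R -> R) :
  nonneg_global_solution G Omega a b u0 v ->
  logistic_flow k Omega a b v.
Proof.
move=> sv; have inO x : x \in Omega -> x \in vclosure G Omega.
  by move=> xO; rewrite finset.in_setU xO.
split=> [x /inO|x t xO t0|x t /inO].
- exact: sol_C0 sv x.
- have [g dg _] := sol_C1 sv xO.
  have dvx : is_derive t 1 (v x) (g t).
    apply: is_derive_within_is_derive => //; apply: dg.
    by rewrite /= in_itv/= ltW.
  suff <- : g t = logistic_rhs k Omega a b (v^~ t) x by [].
  have := sol_eq sv xO t0; rewrite derive1E (@derive_val _ _ _ _ _ _ _ dvx).
  rewrite laplacian_reduced.
    by move=> /eqP; rewrite subr_eq addrC => /eqP.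
  by move=> z zb; rewrite (solution_boundary_average sv zb)// ltW.
- exact: sol_ge0 sv x t.
Qed.

Lemma harmonic_extension_solution (u : V -> R -> R) :
  (forall x, x \in Omega -> u x 0 = u0 x) ->
  (forall x (t : R), x \in Omega -> 0 <= t ->
    is_derive t 1 (u x) (logistic_rhs k Omega a b (u^~ t) x)) ->
  (forall x t, x \in Omega -> 0 <= t -> 0 <= u x t) ->
  nonneg_global_solution G Omega a b u0
    (fun x t => harmonic_extension G Omega (u^~ t) x).
Proof.
move=> u_init du u_ge0.
have cu x : x \in Omega -> {within `[0, +oo[, continuous (u x)}.
  move=> xO; apply: derivable_within_continuous => s.
  rewrite in_itv/= andbT => s0.
  by have [] := du x s xO s0.
have extE x : x \in Omega ->
    (fun t => harmonic_extension G Omega (u^~ t) x) = u x.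
  by move=> xO; apply/funext => t; rewrite harmonic_extension_in.
split.
- move=> x xO; rewrite /= extE//.
  exists (fun t => logistic_rhs k Omega a b (u^~ t) x).
    move=> t /=; rewrite in_itv/= andbT => t0.
    exact/is_derive_is_derive_within/du.
  apply: within_continuousD.
    apply: within_continuous_big_sum => y yO; apply: within_continuous_scale.
    by apply: within_continuousB; exact: cu.
  move=> s; apply: cvgM; first exact: cu.
  apply: cvgB; first exact: cvg_cst.
  exact: (within_continuous_scale (c := b) (cu x xO)).
- move=> x; rewrite finset.in_setU => /orP[xO|xb] /=.
    by rewrite extE//; exact: cu.
  rewrite (_ : (fun t => _) = fun t =>
    \sum_(y in Omega) harmonic_weight G Omega x y * u y t).
    apply: within_continuous_big_sum => y yO; apply: within_continuous_scale.
    exact: cu.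
  by apply/funext => t; rewrite harmonic_extension_boundary.
- move=> x t; rewrite finset.in_setU => /orP[xO|xb] t0.
    by rewrite harmonic_extension_in// u_ge0.
  rewrite harmonic_extension_boundary//; apply: sumr_ge0 => y yO.
  by rewrite mulr_ge0 ?harmonic_weight_ge0 ?u_ge0.
- move=> x t xO t0; rewrite extE// derive1E.
  rewrite (@derive_val _ _ _ _ _ _ _ (du x t xO (ltW t0))).
  rewrite laplacian_reduced; last by move=> z zb; exact: harmonic_extension_fix.
  rewrite (harmonic_extension_in _ _ xO)/= /logistic_rhs.
  rewrite [X in _ - X](_ : _ = diffusion k Omega (u^~ t) x).
    by rewrite addrAC subrr add0r.
  by apply: eq_bigr => y yO; rewrite !harmonic_extension_in.
- move=> z t zb t0; apply/normal_derivative_eq0 => //.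
  exact: harmonic_extension_fix.
- by move=> x xO; rewrite harmonic_extension_in// u_init.
Qed.

End Reduction.

Theorem theorem5p6 (R : realType) (V : finType) (G : host_graph R V)
    (Omega : {set V})
    (Omega_connected : induced_connected G Omega)
    (Omega_simple : induced_simple G Omega)
    (boundary_neq0 : vboundary G Omega != finset.set0)
    (a b : R) (a_gt0 : 0 < a) (b_gt0 : 0 < b)
    (u0 : V -> R)
    (u0_ge0 : forall x, x \in vclosure G Omega -> 0 <= u0 x)
    (u0_neq0 : exists2 x, x \in Omega & u0 x != 0) :
  exists u : V -> R -> R,
    [/\ nonneg_global_solution G Omega a b u0 u,
        forall v : V -> R -> R, nonneg_global_solution G Omega a b u0 v ->
          forall (x : V) (t : R), x \in vclosure G Omega -> 0 <= t -> v x t = u x t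
      & {uniform [set` vclosure G Omega],
          (fun (t : R) (x : V) => u x t) @ +oo --> (fun _ : V => a / b)}].
Proof.
pose k := reduced_kernel G Omega.
have k_ge0 : forall x y, 0 <= k x y := reduced_kernel_ge0 G Omega.
have u0_ge0' x : x \in Omega -> 0 <= u0 x.
  by move=> xO; apply: u0_ge0; rewrite finset.in_setU xO.
have [w [M [w_init dw w_bounds]]] :=
  logistic_flow_exists k_ge0 a_gt0 b_gt0 u0_ge0'.
have w_ge0 x t : x \in Omega -> 0 <= t -> 0 <= w x t.
  by move=> xO t0; have /andP[] := w_bounds x t xO t0.
have w_le x t : x \in Omega -> 0 <= t -> w x t <= M.
  by move=> xO t0; have /andP[] := w_bounds x t xO t0.
have w_flow : logistic_flow k Omega a b w.
  split=> // [x xO|x t xO /ltW]; last exact: dw.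
  apply: derivable_within_continuous => s; rewrite in_itv/= andbT => s0.
  by have [] := dw x s xO s0.
exists (fun x t => harmonic_extension G Omega (w^~ t) x); split.
- by apply: harmonic_extension_solution => // x _; exact: w_init.
- move=> v sv; have v_flow := solution_logistic_flow sv.
  have vw x t : x \in Omega -> 0 <= t -> v x t = w x t.
    move=> xO t0; apply/eqP; rewrite eq_le.
    have init y : y \in Omega -> v y 0 = w y 0.
      by move=> yO; rewrite w_init (sol_init sv).
    apply/andP; split.
      by apply: (logistic_flow_le k_ge0 a_gt0 b_gt0 v_flow w_flow) => //
        y /init->.
    by apply: (logistic_flow_le k_ge0 a_gt0 b_gt0 w_flow v_flow) => //
      y /init->.
  move=> x t; rewrite finset.in_setU => /orP[xO|xb] t0.
    by rewrite harmonic_extension_in// vw.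
  rewrite harmonic_extension_boundary// (solution_boundary_average sv)//.
  by apply: eq_bigr => y yO; rewrite vw.
- have [x0 x0O u0x0] := u0_neq0.
  have w1_gt0 x : x \in Omega -> 0 < w x 1.
    move=> xO; apply: (@logistic_flow_gt0 _ _ k Omega a b k_ge0 a_gt0 b_gt0 w M
      (induced_edge G Omega) x0 x) => //.
    + move=> y z /and3P[yO zO yz]; split=> //.
      by apply: reduced_kernel_gt0; rewrite edge_sym.
    + by rewrite w_init lt_def u0x0 u0_ge0'.
    + exact: Omega_connected.
  have [C [lam [lam_gt0 w_cvg]]] :=
    logistic_flow_attracted k_ge0 a_gt0 b_gt0 w_flow w_le w1_gt0.
  apply: (uniform_exponential_cvg (C := C) lam_gt0) => x t /= xc t1.
  by apply: harmonic_extension_dist xc => y yO; exact: w_cvg.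
Qed.
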